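(* Let $G$ be an abelian group of order $9p^{4s}$, where $p$ is a prime with $p\equiv 1\pmod 4$ and $s$ is an odd positive integer. Then there does not exist a $(9p^{4s},\ r(3p^{2s}+1),\ -3p^{2s}+r^2+3r,\ r^2+r)$-partial difference set in $G$ when $r=(3p^{2s}-3)/4$ or $r=(3p^{2s}+5)/4$.
   Context: For a finite abelian group $G$ of order $v$, a subset $D\subseteq G$ of size $k$ is a $(v,k,\lambda,\mu)$-partial difference set (PDS) if the expressions $gh^{-1}$ with $g,h\in D$, $g\ne h$, represent each non-identity element of $D$ exactly $\lambda$ times and each non-identity element of $G\setminus D$ exactly $\mu$ times. *)

(* Defs.v *)
From mathcomp Require Import all_boot all_order all_algebra all_fingroup.
Set Implicit Arguments. Unset Strict Implicit. Unset Printing Implicit Defensive.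
Import GRing.Theory Num.Theory.
Local Open Scope group_scope.

Definition is_PDS (gT : finGroupType) (D : {set gT}) (v k : nat) (lam mu : int)
  : Prop :=
  #|gT| = v /\ #|D| = k /\
  forall x : gT, x != 1 ->
    (#|[set gh : gT * gT | [&& gh.1 \in D, gh.2 \in D, gh.1 != gh.2
                              & (gh.1 * gh.2^-1)%g == x]]|%:Z)%R
    = if x \in D then lam else mu.

(* Main.v *)
Require Import Defs.
From mathcomp Require Import all_boot all_order all_algebra all_fingroup.
From mathcomp Require Import all_solvable all_field all_character.
From mathcomp Require Import zify ring.
Set Implicit Arguments. Unset Strict Implicit. Unset Printing Implicit Defensive.
Import Order.TTheory GRing.Theory Num.Theory.
Local Open Scope ring_scope.

(** Put [q = p ^ (2 s)] and [n = 3 q].  Every nontrivial character sum of [D] is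
    [r] or [r - n], hence rational, so [D] is invariant under [x |-> x ^+ t] for
    every [t] prime to the order of the group.  Choosing [t = 1] mod 9 and a
    primitive root mod [p], the orbits on a coset [gP] of the Sylow p-subgroup
    ([g] of order dividing 9, [g] itself removed) have length divisible by
    [p - 1], so [#|D :&: gP|] is 0 or 1 mod [p - 1], and it is 0 for [g = 1].
    On the other hand the nine characters trivial on [P] give
    [9 #|D :&: P| = r (n + 1) + 8 r - n a], where [a] counts the sums equal to
    [r - n].  Reducing mod 4 forces [a = 0] resp. [a = 8]; all nontrivial sums
    then agree, and [#|D :&: gP|] for [g] of order 3 is [(p - 1) / 2] resp.
    [1 + (p - 1) / 2] mod [p - 1], because for odd [s] the 2-part of [q - 1] is
    exactly twice that of [p - 1]. *)

(** * Character sums over a partial difference set *)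

(** This form covers both linear characters of the group and characters of a quotient composed with
    [coset]. The condition on inverses says that all values have modulus 1. *)
Definition unitary_hom (gT : finGroupType) (phi : gT -> algC) : Prop :=
  [/\ phi 1%g = 1, {morph phi : x y / (x * y)%g >-> x * y}
    & forall x, phi x^-1%g = (phi x)^*].

Lemma unitary_hom_sum_eq0 (gT : finGroupType) (phi : gT -> algC) y :
  unitary_hom phi -> phi y != 1 -> \sum_x phi x = 0.
Proof.
case=> _ phiM _ phiy; apply/eqP; have: (phi y - 1) * (\sum_x phi x) == 0.
  rewrite mulrBl mul1r subr_eq0 mulr_sumr.
  rewrite [X in _ == X](reindex_inj (mulgI y)) /=.
  by apply/eqP/eq_bigr => x _; rewrite phiM.
by rewrite mulf_eq0 subr_eq0 (negPf phiy).
Qed.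

(** Apply [phi] to the group ring identity D D^(-1) = k + mu (G - 1) + (lam - mu) (D - [1 in D]),
    obtained by grouping the pairs (g, h) by g h^-1. *)
Lemma PDS_char_sum_norm (gT : finGroupType) (D : {set gT}) v k lam mu
    (phi : gT -> algC) :
  is_PDS D v k lam mu -> unitary_hom phi ->
  (\sum_(x in D) phi x) * (\sum_(x in D) phi x)^* =
    k%:R + mu%:~R * (\sum_x phi x - 1)
      + (lam - mu)%:~R * (\sum_(x in D) phi x - (1%g \in D)%:R).
Proof.
move=> [_ [cardD cnt]] [phi1 phiM phiV].
rewrite raddf_sum mulr_suml /=.
under eq_bigr do rewrite mulr_sumr.
rewrite pair_big /= (partition_big (fun gh => gh.1 * gh.2^-1)%g xpredT) //=.
rewrite (bigD1 1%g) //= -!addrA; congr (_ + _).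
  rewrite (eq_bigr (fun=> 1)); last first.
    by move=> [g h] /andP[_ /eqP /= E]; rewrite -phiV -phiM E.
  rewrite (reindex_onto (fun g => (g, g)) fst) /=; last first.
    by move=> [g h] /andP[_ /eqP /eqP]; rewrite -eq_mulgV1 => /eqP /= ->.
  rewrite (eq_bigl (mem D)) ?sumr_const ?cardD // => g.
  by rewrite mulgV !eqxx andbb !andbT.
have sumE (F : gT -> algC) : \sum_x F x - F 1%g = \sum_(x | x != 1%g) F x.
  by rewrite [X in X - _](bigD1 1%g) //= addrAC subrr add0r.
have -> : \sum_x phi x - 1 = \sum_(x | x != 1%g) phi x by rewrite -sumE phi1.
have -> : \sum_(x in D) phi x - (1%g \in D)%:R =
    \sum_(x | x != 1%g) phi x *+ (x \in D).
  by rewrite big_mkcond /= -sumE phi1; congr (_ - _); apply: eq_bigr => x _;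
     case: (x \in D).
rewrite !mulr_sumr -big_split /=; apply: eq_bigr => x x1.
rewrite (eq_bigr (fun=> phi x)); last first.
  by move=> [g h] /andP[_ /eqP /= E]; rewrite -phiV -phiM E.
rewrite (eq_bigl (mem [set gh : gT * gT | [&& gh.1 \in D, gh.2 \in D,
   gh.1 != gh.2 & (gh.1 * gh.2^-1)%g == x]])); last first.
  move=> [g h]; rewrite !inE /= -!andbA; do 2!congr (_ && _).
  by have [->|] := eqVneq g h; rewrite // mulgV eq_sym (negPf x1).
rewrite sumr_const -mulr_natr mulrC pmulrn cnt //.
by case: ifP => _; rewrite ?mulr0n ?mulr1n ?mulr0 ?addr0 // -mulrDl -intrD addrC subrK.
Qed.

(** * Characters of a finite abelian group, and multipliers *)

Lemma linear_char_unitary_hom (gT : finGroupType) (xi : 'CF([set: gT])) :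
  xi \is a linear_char -> unitary_hom xi.
Proof.
move=> lin; split; first exact: lin_char1.
  by move=> x y; rewrite lin_charM ?inE.
by move=> x; rewrite lin_charV_conj ?inE.
Qed.

Lemma irr_neq0_ex (gT : finGroupType) (G : {group gT}) (i : Iirr G) :
  i != 0 -> exists2 y, y \in G & 'chi_i y != 1.
Proof.
move=> i0; apply/exists_inP; apply: contraR i0; rewrite negb_exists_in.
move/forall_inP=> h; rewrite -irr_eq1; apply/eqP/cfun_inP => y Gy.
by rewrite cfun1E Gy; apply/eqP/negPn/h.
Qed.

Lemma abelian_char_orthogonality (gT : finGroupType) (G : {group gT}) x y :
  abelian G -> x \in G -> y \in G ->
  \sum_(i : Iirr G) 'chi_i x * ('chi_i y)^* = #|G|%:R *+ (x == y).
Proof.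
move=> cGG Gx Gy; rewrite second_orthogonality_relation //.
have -> : (y ^: G)%g = [set y].
  apply/eqP; rewrite eqEsubset sub1set class_refl andbT.
  apply/subsetP => _ /imsetP[z Gz ->].
  by rewrite inE conjgE (centsP cGG y Gy z Gz) mulKg.
by rewrite inE (setIidPl _) // sub_cent1 (subsetP cGG).
Qed.

(* A Galois automorphism maps [chi x] to [chi (x ^+ t)] and fixes the sums. *)
Lemma expg_closed_of_int_char_sums (gT : finGroupType) (D : {set gT}) t :
  abelian [set: gT] -> coprime t #|gT| ->
  (forall i : Iirr [set: gT], \sum_(x in D) 'chi_i x \in Num.int) ->
  {in D, forall x, (x ^+ t)%g \in D}.
Proof.
move=> cGG cot intD x0 Dx0; set y := (x0 ^+ t)%g.
have [u uE] := Qn_aut_exists cot.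
have lin := char_abelianP _ cGG.
(* [u] raises the character values to the power [t] and fixes the integral inner sums. *)
have E : \sum_(i : Iirr [set: gT]) (\sum_(x in D) 'chi_i (x ^+ t)%g) * ('chi_i y)^*
       = \sum_(i : Iirr [set: gT]) (\sum_(x in D) 'chi_i x) * ('chi_i y)^*.
  apply: eq_bigr => i _; congr (_ * _); rewrite -[RHS](aut_intr u) //.
  rewrite rmorph_sum; apply: eq_bigr => x _.
  rewrite lin_charX ?inE // uE // -lin_charX ?inE //.
  by rewrite -cardsT expg_cardG ?inE ?lin_char1.
have F (f : gT -> gT) :
    \sum_(i : Iirr [set: gT]) (\sum_(x in D) 'chi_i (f x)) * ('chi_i y)^* =
    \sum_(x in D) #|gT|%:R *+ (f x == y).
  under eq_bigr do rewrite mulr_suml.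
  rewrite exchange_big; apply: eq_bigr => x _.
  by rewrite abelian_char_orthogonality ?inE ?cardsT.
(* By orthogonality each side is #|G| times a count: of the x in [D] with x ^+ t = y, and of those
   with x = y. The first count includes [x0]; the second would be 0 if [y] were outside [D]. *)
have {E} := E; rewrite (F id) (F (expgn^~ t)) => E.
apply/negPn/negP => Dy.
have : \sum_(x in D) (#|gT|%:R *+ (x == y) : algC) = 0.
  apply: big1 => x Dx; case: eqP => // xy; by rewrite -xy Dx in Dy.
rewrite /= in E; rewrite -E (bigD1 x0) //= eqxx => /eqP.
rewrite paddr_eq0 ?ler0n //; last by apply: sumr_ge0 => x _; rewrite mulrn_wge0.
by rewrite pnatr_eq0 -cardsT -leqn0 leqNgt cardG_gt0.
Qed.

(** * Orbits of a power map on cosets of a p-subgroup *)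

Lemma prime_primitive_root p : prime p ->
  exists2 t, coprime t p & forall m, (t ^ m = 1 %[mod p] -> p.-1 %| m)%N.
Proof.
move=> pp; have p1 : (0 < p.-1)%N by rewrite -subn1 subn_gt0 prime_gt1.
pose rs := [seq x <- enum 'F_p | x != 0].
have szrs : size rs = p.-1.
  have -> : rs = enum (predC1 (0 : 'F_p)) by rewrite /rs enumT.
  by rewrite -cardE cardC1 card_Fp.
(* The [p.-1] nonzero elements of 'F_p are distinct roots of X^(p-1) - 1, so one of them is
   primitive. *)
have : has (p.-1).-primitive_root rs.
  apply: has_prim_root => //; last by rewrite szrs.
    apply/allP => x; rewrite mem_filter => /andP[x0 _].
    rewrite unity_rootE; apply/eqP/(mulfI x0).
    by rewrite -exprS prednK ?prime_gt0 // mulr1 -{2}(expf_card x) card_Fp.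
  by rewrite filter_uniq ?enum_uniq.
case/hasP=> w _ prw; have Ew : (w : nat)%:R = w :> 'F_p by rewrite natr_Zp.
exists w => [|m /(congr1 (fun k => k%:R : 'F_p))].
  rewrite coprime_sym prime_coprime // (dvdn_pcharf (pchar_Fp pp)) Ew.
  apply: contraTneq prw => ->; apply/negP => /prim_expr_order/eqP.
  by rewrite expr0n eqn0Ngt p1 /= eq_sym oner_eq0.
rewrite !Fp_nat_mod // natrX Ew => wm.
by rewrite (prim_order_dvd prw) wm.
Qed.

(** The map x |-> x ^+ t permutes the set being counted. On an orbit of length m through g y, with y
    != 1 in [P], t ^ m = 1 modulo the order of y, hence modulo [p]; so [p.-1] divides m. *)
Lemma card_coset_expg_closed (gT : finGroupType) (D : {set gT}) (P : {group gT})
    (p t : nat) (g : gT) :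
  abelian [set: gT] -> coprime t #|gT| -> {in D, forall x, (x ^+ t)%g \in D} ->
  (p.-group P)%g -> (g ^+ t = g)%g ->
  (forall m, t ^ m = 1 %[mod p] -> p.-1 %| m)%N ->
  (p.-1 %| #|(D :&: (g *: P)%g) :\ g|)%N.
Proof.
move=> cGG cot Dt pP gt ordt; set S := _ :\ g.
have inj : injective (fun x : gT => x ^+ t)%g.
  apply: (can_inj (g := fun x => x ^+ expg_invn [set: gT] t)%g) => x.
  by rewrite expgK ?inE // cardsT coprime_sym.
pose sg := perm inj.
have com (x y : gT) : commute x y by apply: (centsP cGG); rewrite inE.
have acts : [acts <[sg]>%g, on S | 'P].
  rewrite cycle_subG !inE /=; apply/subsetP => x; rewrite !inE.
  case/and3P=> xg Dx; rewrite mem_lcoset => Px.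
  rewrite apermE permE -{1}gt (inj_eq inj) xg Dt //= mem_lcoset.
  by rewrite -{1}gt -expVgn -expgMn ?groupX.
rewrite -(acts_sum_card_orbit acts); apply: dvdn_sum => _ /imsetP[x Sx ->].
rewrite -porbitE; apply: ordt; set m := #|_|.
have itE k : iter k sg x = (x ^+ (t ^ k))%g.
  elim: k => [|k IH]; first by rewrite expg1.
  by rewrite iterS IH permE expnSr expgM.
have gE k : (g ^+ (t ^ k) = g)%g.
  by elim: k => [|k IH]; rewrite ?expg1 // expnSr expgM IH.
have := iter_porbit sg x; rewrite -/m itE => xm.
move: Sx; rewrite !inE => /and3P[xg _]; rewrite mem_lcoset => Py.
set y := (g^-1 * x)%g in Py.
have y1 : y != 1%g by rewrite /y -eq_mulVg1 eq_sym.
have /eqP : (y ^+ (t ^ m) = y ^+ 1)%g.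
  by rewrite expg1 /y expgMn // expVgn gE xm.
rewrite eq_expg_mod_order => /eqP E.
have [k oy] := p_natP (mem_p_elt pP Py).
have py : (p %| #[y]%g)%N.
  case: k oy => [/eqP|k ->]; last by rewrite expnS dvdn_mulr.
  by rewrite order_eq1 (negPf y1).
by rewrite -(modn_dvdm (t ^ m) py) E modn_dvdm.
Qed.

(** * Coset counts from characters of the quotient *)

Lemma coset_char_unitary_hom (gT : finGroupType) (P : {group gT})
    (j : Iirr ([set: gT] / P)%g) :
  abelian [set: gT] -> unitary_hom (fun x => 'chi_j (coset P x)).
Proof.
move=> cGG.
have lin := char_abelianP _ (quotient_abelian P cGG).
have NP : [set: gT] \subset 'N(P)%g := sub_abelian_norm cGG (subsetT P).
have inN x : x \in 'N(P)%g by rewrite (subsetP NP) ?inE.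
have inQ x : coset P x \in ([set: gT] / P)%g by rewrite mem_quotient ?inE.
split => [|x y|x] /=; first by rewrite morph1 lin_char1.
  by rewrite morphM ?(lin_charM (lin j) (inQ x) (inQ y)) //; exact: inN.
by rewrite morphV ?(lin_charV_conj (lin j) (inQ x)) //; exact: inN.
Qed.

(** Fourier inversion on G / P for the function counting the elements of [D] in each coset. *)
Lemma card_setI_lcoset_char (gT : finGroupType) (D : {set gT}) (P : {group gT}) g :
  abelian [set: gT] ->
  (#|([set: gT] / P)%g| * #|D :&: (g *: P)%g|)%:R =
    \sum_(j : Iirr ([set: gT] / P)%g)
      (\sum_(x in D) 'chi_j (coset P x)) * ('chi_j (coset P g))^*.
Proof.
move=> cGG.
have NP : [set: gT] \subset 'N(P)%g := sub_abelian_norm cGG (subsetT P).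
have inN x : x \in 'N(P)%g by rewrite (subsetP NP) ?inE.
have inQ x : coset P x \in ([set: gT] / P)%g by rewrite mem_quotient ?inE.
under eq_bigr do rewrite mulr_suml.
rewrite exchange_big /=.
under eq_bigr do rewrite abelian_char_orthogonality ?quotient_abelian // mulrb.
rewrite -big_mkcondr /= sumr_const natrM mulr_natr; congr (_ *+ _).
apply: eq_card => x; rewrite !inE; congr (_ && _).
rewrite mem_lcoset eq_sym eq_mulVg1 -morphV // -morphM ?groupV //.
by apply/idP/eqP => [/coset_id|/coset_idr->].
Qed.

(** * Parameters of negative Latin square type in order n^2 *)

Section NegativeLatinSquare.

Variables (gT : finGroupType) (D : {set gT}) (n r : nat).
Hypothesis pdsD : is_PDS D (n ^ 2) (r * (n + 1))
  (- n%:Z + (r ^ 2)%:Z + (3 * r)%:Z) ((r ^ 2)%:Z + r%:Z).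
Hypothesis nr : (2 * r != n)%N.

Let lam_mu : (- n%:Z + (r ^ 2)%:Z + (3 * r)%:Z - ((r ^ 2)%:Z + r%:Z))%:~R
  = 2 * r%:R - n%:R :> algC.
Proof.
rewrite (_ : _ - _ = 2 * r%:Z - n%:Z); last by lia.
by rewrite intrB intrM.
Qed.

Let mu_alg : ((r ^ 2)%:Z + r%:Z)%:~R = r%:R ^+ 2 + r%:R :> algC.
Proof. by rewrite intrD -natrX. Qed.

Let nr_alg : 2 * r%:R - n%:R != 0 :> algC.
Proof. by rewrite subr_eq0 -natrM eqr_nat. Qed.

(** For the trivial character the parameters already balance without the term in [1 in D], which
    leaves (lam - mu) [1 in D] = 0; [nr] says that lam - mu = 2r - n is nonzero. *)
Lemma negLatin_PDS_notin1 : 1%g \notin D.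
Proof.
have hom : unitary_hom (fun _ : gT => 1 : algC).
  by split=> [|x y|x] /=; rewrite ?mulr1 ?rmorph1.
have := PDS_char_sum_norm pdsD hom; rewrite lam_mu mu_alg.
case: pdsD => cG [cD _].
rewrite !sumr_const cD cG conjC_nat natrM natrD natrX.
move: (1%g \in D) => e E.
have /eqP : (2 * r%:R - n%:R) * e%:R = 0 :> algC.
  by move/eqP: E; rewrite -subr_eq0 => /eqP E0; rewrite -E0; ring.
by rewrite mulf_eq0 (negPf nr_alg) /= pnatr_eq0; case: (e).
Qed.

(** The norm identity is self-conjugate on the left, so the sum X is real. It then reads (X - r)(X -
    (r - n)) = 0. *)
Lemma negLatin_PDS_char_sum (phi : gT -> algC) y :
  unitary_hom phi -> phi y != 1 ->
  \sum_(x in D) phi x = r%:R \/ \sum_(x in D) phi x = r%:R - n%:R.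
Proof.
move=> hom phiy; have := PDS_char_sum_norm pdsD hom.
rewrite lam_mu mu_alg (unitary_hom_sum_eq0 hom phiy) (negPf negLatin_PDS_notin1).
rewrite subr0 natrM natrD; set X := \sum_(x in D) _ => E.
have Xreal : X^* = X.
  have := congr1 (fun z : algC => z^*) E.
  rewrite !(rmorphD, rmorphM, rmorphB, rmorphN, rmorphXn, rmorph0, rmorph1).
  by rewrite /= !rmorph_nat /= conjCK mulrC E => /addrI/(mulfI nr_alg)/esym.
have /eqP : (X - r%:R) * (X - (r%:R - n%:R)) = 0.
  by move/eqP: E; rewrite Xreal -subr_eq0 => /eqP E0; rewrite -E0; ring.
by rewrite mulf_eq0 !subr_eq0 => /orP[] /eqP; [left|right].
Qed.

Lemma negLatin_PDS_expg_closed t : abelian [set: gT] -> coprime t #|gT| ->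
  {in D, forall x, (x ^+ t)%g \in D}.
Proof.
move=> cGG cot; apply: expg_closed_of_int_char_sums => // i.
have lin := char_abelianP _ cGG i.
have [->|/irr_neq0_ex[y _ y1]] := eqVneq i 0.
  by apply: rpred_sum => x _; rewrite irr0 cfun1E inE rpred1.
have [|] := negLatin_PDS_char_sum (linear_char_unitary_hom lin) y1 => ->.
  exact: rpred_nat.
by rewrite rpredB ?rpred_nat.
Qed.

Section Quotient.

Variable P : {group gT}.
Hypothesis cGG : abelian [set: gT].

Let G : {group gT} := [set: gT]%G.
Let X (j : Iirr (G / P)%g) : algC := \sum_(x in D) 'chi_j (coset P x).
Let A : {set Iirr (G / P)%g} := [set j | (j != 0) && (X j == r%:R - n%:R)].

Let inQ x : coset P x \in (G / P)%g.
Proof.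
by rewrite mem_quotient ?inE.
Qed.

Let X0 : X 0 = (r * (n + 1))%:R.
Proof.
rewrite /X (eq_bigr (fun=> 1)); first by rewrite sumr_const; case: pdsD => _ [->].
by move=> x _; rewrite irr0 cfun1E inQ.
Qed.

Let XE j : j != 0 -> X j = r%:R - n%:R * (j \in A)%:R.
Proof.
move=> j0; rewrite inE j0 /=; case: eqP => [->|Xj]; first by rewrite mulr1.
have [u + y1] := irr_neq0_ex j0; case/morphimP=> y _ _ uE; rewrite uE in y1.
have [Xr|//] : X j = r%:R \/ X j = r%:R - n%:R.
  exact: negLatin_PDS_char_sum (coset_char_unitary_hom j cGG) y1.
by rewrite mulr0 subr0.
Qed.

Let card_nonprincipal : #|[pred j : Iirr (G / P)%g | j != 0]| = #|(G / P)%g|.-1.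
Proof.
by rewrite cardC1 card_Iirr_abelian ?quotient_abelian.
Qed.

(** Here [a] counts the nonprincipal characters of G / P with sum r - n; inversion at the identity
    gives the equation. In the two extreme cases all nonprincipal sums agree, so every nontrivial
    coset meets [D] equally often. *)
Lemma negLatin_PDS_card_setI_subgroup : exists a : nat,
  [/\ (a <= #|(G / P)%g|.-1)%N,
      (#|(G / P)%g| * #|D :&: P| + n * a = r * (n + 1) + #|(G / P)%g|.-1 * r)%N,
      a = 0 -> forall g, g \notin P ->
        (#|(G / P)%g| * #|D :&: (g *: P)%g| = r * n)%N
    & a = #|(G / P)%g|.-1 -> forall g, g \notin P ->
        (#|(G / P)%g| * #|D :&: (g *: P)%g| = (r + 1) * n)%N].
Proof.
have lin := char_abelianP _ (quotient_abelian P cGG).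
have AC1 : A \subset [pred j | j != 0].
  by apply/subsetP => j; rewrite !inE => /andP[].
(* The boolean [b] treats both extremes: the common sum is r - n b. The nonprincipal characters sum
   to -1 at a nontrivial coset. *)
have const b g : (forall j, j != 0 -> (j \in A) = b) -> g \notin P ->
    (#|(G / P)%g| * #|D :&: (g *: P)%g| = (r + b) * n)%N.
  move=> Ab gP; apply/eqP; rewrite -(eqr_nat algC) card_setI_lcoset_char //.
  have sum0 : \sum_(j : Iirr (G / P)%g) ('chi_j (coset P g))^* = 0.
    have := abelian_char_orthogonality (quotient_abelian P cGG) (group1 _) (inQ g).
    rewrite eq_sym; have [/coset_idr gP'|_] := eqVneq.
      by rewrite gP' ?(subsetP (sub_abelian_norm cGG (subsetT P))) ?inE in gP.
    rewrite mulr0n => E0; rewrite -[RHS]E0; apply: eq_bigr => j _.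
    by rewrite lin_char1 ?mul1r.
  rewrite (eq_bigr (fun j => X j * ('chi_j (coset P g))^*)) //.
  move: sum0; rewrite (bigD1 0) //= => sum0; rewrite (bigD1 0) //= X0.
  move: sum0; rewrite irr0 cfun1E inQ conjC1 mulr1.
  move=> /(canRL (addKr _)) sum0.
  rewrite (eq_bigr (fun j => (r%:R - n%:R * b%:R) * ('chi_j (coset P g))^*)).
    by rewrite -mulr_sumr sum0 !natrM !natrD; apply/eqP; ring.
  by move=> j j0; rewrite XE // Ab.
exists #|A|; split.
- by rewrite -card_nonprincipal subset_leq_card.
- apply/eqP; rewrite -(eqr_nat algC) natrD.
  have -> : D :&: P = D :&: (1 *: P)%g by rewrite mul1g.
  rewrite card_setI_lcoset_char //.
  rewrite (eq_bigr X); last first.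
    by move=> j _; rewrite morph1 lin_char1 // conjC1 mulr1.
  rewrite (bigD1 0) //= X0 (eq_bigr _ XE) sumrB -mulr_sumr sumr_const.
  rewrite card_nonprincipal.
  have -> : \sum_(j | j != 0) (j \in A)%:R = #|A|%:R :> algC.
    rewrite -sum1_card natr_sum big_mkcond [RHS]big_mkcond; apply: eq_bigr => j _.
    by rewrite inE; case: (j != 0) => //=; case: (_ == _).
  by rewrite !natrD !natrM -mulr_natr; apply/eqP; ring.
- move/eqP; rewrite cards_eq0 => /eqP A0 g; rewrite -[r in RHS]addn0.
  by apply: (const false) => j _; rewrite A0 inE.
- move=> cA g; apply: (const true) => j j0.
  have /subset_cardP := etrans cA (esym card_nonprincipal).
  by move/(_ AC1) => ->.
Qed.

End Quotient.

End NegativeLatinSquare.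

(** * Arithmetic of the counts *)

(** Records that (q - 1) / (p - 1) is twice an odd number, for q = p ^ (2 s): the odd [s] makes (p^s
    - 1) / (p - 1) odd, and p^s + 1 is 2 mod 4. *)
Lemma prime_1mod4_exp_sub1 p s : prime p -> (p %% 4 = 1)%N -> odd s ->
  exists u w, [/\ (0 < u)%N, p = (4 * u + 1)%N
    & (p ^ (2 * s) = 8 * u * (2 * w + 1) + 1)%N].
Proof.
move=> pp p4 os; have p1 := prime_gt1 pp.
pose u := (p %/ 4)%N.
have pE : p = (4 * u + 1)%N by rewrite /u; lia.
have [v vE] : exists v, (p ^ s = 4 * u * (2 * v + 1) + 1)%N.
  have -> : s = (2 * s./2 + 1)%N by lia.
  elim: s./2 => [|m [v IH]]; first by exists 0; rewrite expn1; lia.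
  have -> : (2 * m.+1 + 1 = 2 + (2 * m + 1))%N by lia.
  rewrite expnD IH pE.
  exists (v * (16 * u ^ 2 + 8 * u + 1) + 8 * u ^ 2 + 6 * u + 1)%N.
  by rewrite -!mulnn; ring.
exists u; rewrite [(2 * s)%N]mulnC expnM vE.
exists (v + u * (2 * v + 1) ^ 2)%N; split => //; first by lia.
by rewrite -!mulnn; ring.
Qed.

Lemma negLatin_counts_absurd u w q r a f1 fg e :
  (0 < u)%N -> (q = 8 * u * (2 * w + 1) + 1)%N -> (q %% 3 = 1)%N ->
  (4 * r = 3 * q - 3)%N \/ (4 * r = 3 * q + 5)%N -> (a <= 8)%N ->
  (9 * f1 + 3 * q * a = r * (3 * q + 1) + 8 * r)%N -> (4 * u %| f1)%N ->
  (e <= 1)%N -> (4 * u %| fg - e)%N -> (e <= fg)%N ->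
  (a = 0 -> 9 * fg = r * (3 * q))%N -> (a = 8 -> 9 * fg = (r + 1) * (3 * q))%N ->
  False.
Proof.
move=> u0 qE q3 rE a8 eq1 /dvdnP[c1 f1E] e1 /dvdnP[c fgE] efg a0E a8E.
(* With y = (q - 1) / 8 and y^2 = u z, every count is linear in multiples of [u], which can then be
   cancelled. *)
pose y := (u * (2 * w + 1))%N; pose z := ((2 * w + 1) * y)%N.
have qy : q = (8 * y + 1)%N by rewrite qE /y; ring.
have yy : (y * y = u * z)%N by rewrite /z {1}/y; ring.
have f1A : f1 = (4 * (u * c1))%N by rewrite f1E; ring.
have fgA : fg = (4 * (u * c) + e)%N by rewrite -(subnK efg) fgE; ring.
have yw : y = (2 * (u * w) + u)%N by rewrite /y; ring.
have cancel b d : (u * b = u * d)%N -> b = d.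
  by move/eqP; rewrite eqn_pmul2l // => /eqP.
have [rE'|rE'] : r = (6 * y)%N \/ r = (6 * y + 2)%N by lia.
  have E1 : (3 * f1 + q * a = 48 * (u * z) + 24 * y)%N.
    by move: eq1; rewrite rE' qy -yy; lia.
  (* Since q = 1 modulo 4 and 3, and 4 divides [f1], both 4 and 3 divide [a], which is at most 8. *)
  have a0 : a = 0.
    clear eq1 a0E a8E; rewrite {}qy in E1 q3.
    by case: a a8 E1 => [|[|[|[|[|[|[|[|[|//]]]]]]]]] _; lia.
  have Eg : fg = (16 * (u * z) + 2 * y)%N.
    apply/eqP; rewrite -(eqn_pmul2l (isT : 0 < 9)%N) a0E // rE' qy -yy.
    by apply/eqP; ring.
  have e0 : e = 0 by lia.
  (* Cancelling [u] leaves a left side that is 2 mod 4. *)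
  have /cancel : (u * (16 * z + 4 * w + 2) = u * (4 * c))%N by lia.
  lia.
have E1 : (3 * f1 + q * a = 48 * (u * z) + 40 * y + 8)%N.
  by move: eq1; rewrite rE' qy -yy; lia.
(* Now [a] is 0 mod 4 and, as 3 divides y, 2 mod 3. *)
have a8' : a = 8.
  clear eq1 a0E a8E; rewrite {}qy in E1 q3.
    by case: a a8 E1 => [|[|[|[|[|[|[|[|[|//]]]]]]]]] _; lia.
have Eg : fg = (16 * (u * z) + 10 * y + 1)%N.
  apply/eqP; rewrite -(eqn_pmul2l (isT : 0 < 9)%N) a8E // rE' qy -yy.
  by apply/eqP; ring.
have e0 : e = 1 by lia.
have /cancel : (u * (16 * z + 20 * w + 10) = u * (4 * c))%N by lia.
lia.
Qed.

Theorem theorem7 (gT : finGroupType) (p s r : nat) :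
  abelian [set: gT] ->
  prime p -> (p %% 4 = 1)%N -> odd s -> (0 < s)%N ->
  #|gT| = (9 * p ^ (4 * s))%N ->
  ((4 * r = 3 * p ^ (2 * s) - 3)%N \/ (4 * r = 3 * p ^ (2 * s) + 5)%N) ->
  ~ exists D : {set gT},
      is_PDS D (9 * p ^ (4 * s)) (r * (3 * p ^ (2 * s) + 1))
        (- (3 * p ^ (2 * s))%:Z + (r ^ 2)%:Z + (3 * r)%:Z)%R
        ((r ^ 2)%:Z + r%:Z)%R.
Proof.
move=> cGG pp p4 os s0 cG rE [D pdsD].
have [u [w [u0 pE qE]]] := prime_1mod4_exp_sub1 pp p4 os.
set q := (p ^ (2 * s))%N in qE rE pdsD.
have p_3 : coprime 3 p.
  rewrite prime_coprime // dvdn_prime2 //.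
  by apply/negP => /eqP E; rewrite -E in p4.
have q3 : (q %% 3 = 1)%N.
  rewrite /q expnM -modnXm; have -> : (p ^ 2 %% 3 = 1)%N.
    rewrite -modnXm; have := ltn_pmod p (isT : 0 < 3)%N.
    by move: p_3; rewrite prime_coprime // /dvdn; case: (p %% 3)%N => [|[|[|]]].
  by rewrite exp1n.
rewrite (_ : 9 * p ^ (4 * s) = (3 * q) ^ 2)%N in pdsD; last first.
  by rewrite expnMn /q -expnM; congr (_ * _ ^ _)%N; lia.
have nr : (2 * r != 3 * q)%N by lia.
have p_9 : coprime 9 p by rewrite -[9%N]/(3 ^ 2)%N coprimeXl.
have [t0 t0p ordt0] := prime_primitive_root pp.
(* 1 mod 9 makes the power map fix elements of order dividing 9; [t0] mod [p] makes its orbits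
   long. *)
pose t := chinese 9 p 1 t0.
have t9 : (t = 1 %[mod 9])%N := chinese_modl p_9 1 t0.
have tp : (t = t0 %[mod p])%N := chinese_modr p_9 1 t0.
have cot : coprime t #|gT|.
  rewrite cG coprimeMr coprimeXr; first by rewrite -coprime_modl t9.
  by rewrite -coprime_modl tp coprime_modl.
have ordt m : (t ^ m = 1 %[mod p] -> p.-1 %| m)%N.
  by move=> tm; apply: ordt0; rewrite -tm -modnXm -tp modnXm.
have Dt := negLatin_PDS_expg_closed pdsD nr cGG cot.
have [P sylP] := Sylow_exists p [set: gT].
have pP : (p.-group P)%g := pHall_pgroup sylP.
have cP : #|P| = (p ^ (4 * s))%N.
  rewrite (card_Hall sylP) cardsT cG partnM //; last by rewrite expn_gt0 prime_gt0.
  rewrite part_p'nat; last by rewrite p'natE // -prime_coprime // coprime_sym.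
  by rewrite mul1n part_pnat_id // pnatX pnat_id.
have NP : [set: gT] \subset 'N(P)%g := sub_abelian_norm cGG (subsetT P).
have cQ : #|([set: gT] / P)%g| = 9.
  rewrite card_quotient //; apply/eqP.
  by rewrite -(eqn_pmul2l (cardG_gt0 P)) Lagrange ?subsetT // cardsT cG cP mulnC.
have [g _ og] : {g : gT | g \in [set: gT] & #[g]%g = 3}.
  by apply: Cauchy => //; rewrite cardsT cG -[9%N]/(3 * 3)%N -mulnA dvdn_mulr.
have gP : g \notin P.
  apply/negP => /order_dvdG; rewrite og cP; apply/negP.
  by rewrite -prime_coprime // coprimeXr.
have gt : (g ^+ t = g)%g.
  apply/eqP; rewrite -[X in _ == X]expg1 eq_expg_mod_order og.
  by rewrite -(modn_dvdm t (isT : 3 %| 9)%N) t9.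
have p1E : p.-1 = (4 * u)%N by rewrite pE addn1.
have [a [a8 E1 a0E a8E]] := negLatin_PDS_card_setI_subgroup pdsD nr P cGG.
rewrite cQ in a8 E1 a0E a8E.
apply: (@negLatin_counts_absurd u w q r a #|D :&: P| #|D :&: (g *: P)%g|
  (g \in D)) => //.
(* For the coset [P] itself the removed point is 1, which is not in [D]. *)
- have := card_coset_expg_closed cGG cot Dt pP (expg1n _ t) ordt.
  rewrite p1E mul1g (setDidPl _) // disjoint_sym disjoints1 inE.
  by rewrite (negPf (negLatin_PDS_notin1 pdsD nr)).
- by case: (g \in D).
- have := card_coset_expg_closed cGG cot Dt pP gt ordt.
  rewrite p1E (cardsD1 g (D :&: _)) inE lcoset_refl andbT.
  by rewrite addKn.
- by rewrite (cardsD1 g (D :&: _)) inE lcoset_refl andbT leq_addr.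
- by move=> a0; apply: a0E.
- by move=> a8'; apply: a8E.
Qed.
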